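(* There is an infinite binary branching computable tree that has no infinite computably enumerable chains and no infinite computably enumerable antichains.
   Context: A tree is a partial order $(T,\preceq)$ with a least element (the root) such that for every $n\in T$ the set $\{m\in T: m\preceq n\}$ is finite and linearly ordered. A tree is computable if $T\subseteq\omega$ is computable and $\preceq$ is computable. It is binary branching if every node has at most two immediate successors. A chain is a set of pairwise comparable nodes; an antichain is a set of pairwise incomparable nodes. *)

(* Defs.v *)
From mathcomp Require Import all_boot all_classical.

Set Implicit Arguments.
Unset Strict Implicit.
Unset Printing Implicit Defensive.

Local Open Scope classical_set_scope.
Local Open Scope card_scope.

(* Syntax of the mu-recursive (partial recursive) functions.  Programs carry  *)
(* no arity: they are run on argument lists by [returns] below.               *)
Inductive program : Type :=
| Zero
| Succ
| Proj of nat
| Comp of program & seq program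
| PrimRec of program & program
| Mu of program.

(* [returns p v y]: program p, run on the arguments v, halts with output y.   *)
(* A program is undefined on argument lists that are too short and ignores    *)
(* superfluous arguments.  The arguments of the step program of [PrimRec] are *)
(* (counter, previous value, parameters); [Mu f] searches for the least zero  *)
(* of f in its first argument, all earlier values being defined and nonzero.  *)
Inductive returns : program -> seq nat -> nat -> Prop :=
| returns_Zero v : returns Zero v 0
| returns_Succ x v : returns Succ (x :: v) x.+1
| returns_Proj i v : i < size v -> returns (Proj i) v (nth 0 v i)
| returns_Comp f gs v w y :
    size w = size gs ->
    (forall i, i < size gs -> returns (nth Zero gs i) v (nth 0 w i)) ->
    returns f w y -> returns (Comp f gs) v y
| returns_PrimRec0 f g v y :
    returns f v y -> returns (PrimRec f g) (0 :: v) y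
| returns_PrimRecS f g n v r y :
    returns (PrimRec f g) (n :: v) r -> returns g [:: n, r & v] y ->
    returns (PrimRec f g) (n.+1 :: v) y
| returns_Mu f v y (r : nat -> nat) :
    (forall z, z < y -> returns f (z :: v) (r z).+1) ->
    returns f (y :: v) 0 -> returns (Mu f) v y.

Definition computable_set (A : set nat) : Prop :=
  exists p, forall x, returns p [:: x] `[< A x >].

Definition computable_rel (R : nat -> nat -> Prop) : Prop :=
  exists p, forall x y, returns p [:: x; y] `[< R x y >].

Definition ce_set (A : set nat) : Prop :=
  exists p, A = [set x | exists y, returns p [:: x] y].

Definition is_chain (T : set nat) (le : nat -> nat -> Prop) (C : set nat) :=
  C `<=` T /\ forall x y, C x -> C y -> le x y \/ le y x.

Definition is_antichain (T : set nat) (le : nat -> nat -> Prop) (A : set nat) :=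
  A `<=` T /\ forall x y, A x -> A y -> x <> y -> ~ le x y /\ ~ le y x.

Record is_tree (T : set nat) (le : nat -> nat -> Prop) : Prop := IsTree {
  tree_dom : forall m n, le m n -> T m /\ T n;
  tree_refl : forall n, T n -> le n n;
  tree_antisym : forall m n, le m n -> le n m -> m = n;
  tree_trans : forall l m n, le l m -> le m n -> le l n;
  tree_root : exists2 r, T r & forall n, T n -> le r n;
  tree_below_finite : forall n, T n -> finite_set [set m | le m n];
  tree_below_chain : forall n, T n -> is_chain T le [set m | le m n]
}.

Definition computable_tree (T : set nat) (le : nat -> nat -> Prop) : Prop :=
  [/\ is_tree T le, computable_set T & computable_rel le].

Definition strictly_below (le : nat -> nat -> Prop) (m n : nat) : Prop :=
  le m n /\ m <> n.

Definition immediate_succ (le : nat -> nat -> Prop) (m n : nat) : Prop :=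
  strictly_below le m n /\
  ~ exists k, strictly_below le m k /\ strictly_below le k n.

Definition binary_branching (T : set nat) (le : nat -> nat -> Prop) : Prop :=
  forall m, T m -> [set n | immediate_succ le m n] #<= `I_2.

(* Main.v *)
Require Import Defs.
From mathcomp Require Import all_boot all_classical zify.

Set Implicit Arguments.
Unset Strict Implicit.
Unset Printing Implicit Defensive.

Local Open Scope classical_set_scope.
Local Open Scope card_scope.

(* A finite injury argument.  Node s is placed at a position [node s] of the  *)
(* full binary tree, and nodes are compared by comparing positions.  At each  *)
(* stage s there is an ascending sequence of positions, the locks, starting   *)
(* with the root: lock j+1 looks for an already placed node x in the e-th     *)
(* c.e. set W, e = j./2, strictly above lock j.  If there is none it stays at *)
(* lock j; otherwise it moves to x when j is odd, and to the child of lock j  *)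
(* that is not below x when j is even.  Node s goes to the least free         *)
(* position comparable with lock s.  By induction on j, lock j converges, so  *)
(* all but finitely many nodes lie above its limit.  If W is infinite, a      *)
(* witness x is therefore found and W contains a further node above the limit *)
(* of lock j+1: for odd j it is above x, so W is not an antichain; for even j *)
(* it is incomparable with x, so W is not a chain.                            *)
(* The construction is primitive recursive, given a step-bounded universal    *)
(* machine.                                                                   *)

(** * Total computable functions *)

(** All natural numbers are nodes, ordered by the ancestor relation [pre] between their positions.
    For each c.e. set there is an even requirement, that it is no infinite chain, and an odd one,
    that it is no infinite antichain. A requirement acts by confining almost all nodes to a cone of
    the full binary tree. An element [x] of the set lying strictly inside the current cone is
    enough: the cone above [x] forces later elements to be comparable with [x], and the cone on the
    other side of the apex, given by [flip], forces them to be incomparable with it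
    ([flip_incomparable]). The cones are nested, and each one settles once the earlier ones have
    ([lock_limit_exists]).

    An infinite set meets every limit cone outside any finite set of positions ([infinite_above]),
    so each requirement finds its [x] and later a second element ([requirement]). Always taking the
    least free position keeps the occupied positions closed under parents ([node_par]), hence the
    order is binary branching. Computability rests on [halts_atP], which enumerates the c.e. sets in
    a step-bounded way, and on [pr_node]. *)

Definition pr (n : nat) (F : seq nat -> nat) : Prop :=
  exists p, forall v, size v = n -> returns p v (F v).

Create HintDb pr discriminated.

Lemma pr_ext n F G :
  (forall v, size v = n -> F v = G v) -> pr n F -> pr n G.
Proof. by move=> FG [p pP]; exists p => v sv; rewrite -FG //; exact: pP. Qed.

Lemma pr_comp n (Gs : seq (seq nat -> nat)) F :
  pr (size Gs) F -> (forall i, i < size Gs -> pr n (nth (fun=> 0) Gs i)) ->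
  pr n (fun v => F [seq G v | G <- Gs]).
Proof.
move=> [p pP] GsP.
have [ps [sps psP]] : exists ps, size ps = size Gs /\
    forall i, i < size Gs -> forall v, size v = n ->
      returns (nth Zero ps i) v (nth (fun=> 0) Gs i v).
  elim: Gs GsP {F p pP} => [|G Gs IH] GsP; first by exists [::].
  have [ps [sps psP]] := IH (fun i => GsP i.+1).
  have [p pP] := GsP 0 isT.
  exists (p :: ps); split; first by rewrite /= sps.
  by move=> [|i] //; exact: psP.
exists (Comp p ps) => v sv.
apply: (@returns_Comp _ _ _ [seq G v | G <- Gs]).
- by rewrite size_map sps.
- move=> i; rewrite sps => iGs.
  by rewrite (nth_map (fun=> 0)) //; exact: psP.
- by apply: pP; rewrite size_map.
Qed.

Lemma pr_app1 f n A :
  pr 1 (fun v => f (nth 0 v 0)) -> pr n A -> pr n (fun v => f (A v)).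
Proof.
by move=> fP AP; apply: (@pr_comp n [:: A] _ fP) => -[].
Qed.

Lemma pr_app2 f n A B :
  pr 2 (fun v => f (nth 0 v 0) (nth 0 v 1)) -> pr n A -> pr n B ->
  pr n (fun v => f (A v) (B v)).
Proof.
by move=> fP AP BP; apply: (@pr_comp n [:: A; B] _ fP) => -[|[]].
Qed.

Lemma pr_app3 f n A B C :
  pr 3 (fun v => f (nth 0 v 0) (nth 0 v 1) (nth 0 v 2)) ->
  pr n A -> pr n B -> pr n C -> pr n (fun v => f (A v) (B v) (C v)).
Proof.
by move=> fP AP BP CP; apply: (@pr_comp n [:: A; B; C] _ fP) => -[|[|[]]].
Qed.

Lemma pr_app4 f n A B C D :
  pr 4 (fun v => f (nth 0 v 0) (nth 0 v 1) (nth 0 v 2) (nth 0 v 3)) ->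
  pr n A -> pr n B -> pr n C -> pr n D ->
  pr n (fun v => f (A v) (B v) (C v) (D v)).
Proof.
move=> fP AP BP CP DP.
by apply: (@pr_comp n [:: A; B; C; D] _ fP) => -[|[|[|[]]]].
Qed.

Lemma pr_var n i : i < n -> pr n (fun v => nth 0 v i).
Proof. by move=> lt_in; exists (Proj i) => v sv; apply: returns_Proj; rewrite sv. Qed.

Lemma pr_var_drop n k i : k + i < n -> pr n (fun v => nth 0 (drop k v) i).
Proof.
move=> lt_in; apply: pr_ext (pr_var lt_in) => v _; by rewrite nth_drop.
Qed.

Lemma pr_succ n F : pr n F -> pr n (fun v => (F v).+1).
Proof.
apply: (@pr_app1 S); exists Succ => -[|x v] // _; exact: returns_Succ.
Qed.

Lemma pr_const n c : pr n (fun=> c).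
Proof.
by elim: c => [|c /pr_succ //]; exists Zero => v _; exact: returns_Zero.
Qed.
#[local] Hint Resolve pr_const pr_succ : pr.
#[local] Hint Extern 1 (pr _ (fun v => nth _ v _)) => (apply: pr_var; done) : pr.
#[local] Hint Extern 1 (pr _ (fun v => nth _ (drop _ v) _)) => (apply: pr_var_drop; done) : pr.

(** The recursion is run on the extended list [N v :: v], so that the parameters of [PrimRec] are a
    full copy of [v]; the projections in [Gs] supply this copy. *)
Lemma pr_rec n N F G : pr n N -> pr n F ->
  pr n.+2 (fun w => G (nth 0 w 0) (nth 0 w 1) (drop 2 w)) ->
  pr n (fun v => nat_rec (fun=> nat) (F v) (fun k r => G k r v) (N v)).
Proof.
move=> NP [f fP] [g gP].
pose R w := nat_rec (fun=> nat) (F (behead w)) (fun k r => G k r (behead w)) (head 0 w).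
pose Gs := N :: [seq (fun v => nth 0 v i) | i <- iota 0 n].
have -> : (fun v => nat_rec (fun=> nat) (F v) (fun k r => G k r v) (N v)) =
          (fun v => R (N v :: v)) by [].
apply: (@pr_ext _ (fun v => R [seq A v | A <- Gs])).
  move=> v sv; rewrite /Gs /=; congr (R (_ :: _)); rewrite -map_comp -[RHS](mkseq_nth 0) sv.
  by apply: eq_map.
apply: pr_comp; last first.
  move=> [|i] //=; rewrite size_map size_iota => lt_in.
  by rewrite (nth_map 0) ?size_iota // nth_iota //; exact: pr_var.
exists (PrimRec f g) => -[|k v] //=; rewrite size_map size_iota => -[sv].
rewrite /R /=; elim: k => [|k IH] /=; first by apply: returns_PrimRec0; exact: fP.
apply: returns_PrimRecS IH _.
have := gP (k :: _ :: v); rewrite /= drop0 sv; exact.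
Qed.

Lemma pr_iter n N F G : pr n N -> pr n F ->
  pr n.+1 (fun w => G (nth 0 w 0) (drop 1 w)) ->
  pr n (fun v => iter (N v) (fun r => G r v) (F v)).
Proof.
move=> NP FP GP.
apply: (@pr_ext _ (fun v => nat_rec (fun=> nat) (F v) (fun=> fun r => G r v) (N v))).
  by move=> v _; elim: (N v) => //= k ->.
apply: (@pr_rec n N F (fun k r v => G r v)) => //.
(* These projections discard the counter, which is argument 0 of the step function in [pr_rec]. *)
pose Gs := [seq (fun v => nth 0 v i) | i <- iota 1 n.+1].
apply: (@pr_ext _ (fun w => (fun w => G (nth 0 w 0) (drop 1 w)) [seq A w | A <- Gs])).
  move=> [|k v] //= [sv].
  suff -> : [seq A (k :: v) | A <- [seq (fun v => nth 0 v i) | i <- iota 2 n]] = behead v.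
    by case: v sv => //= r v _; rewrite !drop0.
  rewrite -map_comp; apply: (@eq_from_nth _ 0).
    by rewrite size_map size_iota size_behead sv.
  move=> i; rewrite size_map size_iota => lt_in.
  by rewrite (nth_map 0) ?size_iota // nth_iota //= nth_behead.
apply: (@pr_comp _ Gs (fun w => G (nth 0 w 0) (drop 1 w))).
  by rewrite size_map size_iota.
move=> i; rewrite size_map size_iota => lt_in.
by rewrite (nth_map 0) ?size_iota // nth_iota //; apply: pr_var; rewrite add1n.
Qed.

Lemma pr_add n A B : pr n A -> pr n B -> pr n (fun v => A v + B v).
Proof.
move=> AP BP; apply: (@pr_ext _ (fun v => iter (B v) (fun r => r.+1) (A v))).
  by move=> v _; rewrite iter_succn.
by apply: pr_iter => //; auto with pr.
Qed.

Lemma pr_pred n A : pr n A -> pr n (fun v => (A v).-1).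
Proof.
move=> AP.
apply: (@pr_ext _ (fun v => nat_rec (fun=> nat) 0 (fun k _ => k) (A v))).
  by move=> v _; case: (A v).
by apply: pr_rec => //; auto with pr.
Qed.
#[local] Hint Resolve pr_add pr_pred : pr.

Lemma pr_sub n A B : pr n A -> pr n B -> pr n (fun v => A v - B v).
Proof.
move=> AP BP; apply: (@pr_ext _ (fun v => iter (B v) (fun r => r.-1) (A v))).
  by move=> v _; elim: (B v) => [|b /= ->]; rewrite ?subn0 ?subnS.
by apply: pr_iter => //; auto with pr.
Qed.

Lemma pr_mul n A B : pr n A -> pr n B -> pr n (fun v => A v * B v).
Proof.
apply: (@pr_app2 muln).
apply: (@pr_ext _ (fun v => iter (nth 0 v 0) (fun r => nth 0 v 1 + r) 0)).
  by move=> v _; rewrite iter_addn_0 mulnC.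
by apply: (@pr_iter _ _ _ (fun r v => nth 0 v 1 + r)); auto with pr.
Qed.
#[local] Hint Resolve pr_sub pr_mul : pr.

Lemma pr_half n A : pr n A -> pr n (fun v => (A v)./2).
Proof.
move=> AP.
(* Based on [k.+1./2 = k - k./2]. *)
apply: (@pr_ext _ (fun v => nat_rec (fun=> nat) 0 (fun k r => k - r) (A v))).
  move=> v _; elim: (A v) => //= k ->; lia.
by apply: pr_rec => //; auto with pr.
Qed.

Lemma pr_leq n A B :
  pr n A -> pr n B -> pr n (fun v => nat_of_bool (A v <= B v)).
Proof.
move=> AP BP; apply: (@pr_ext _ (fun v => 1 - (A v - B v))); last by auto with pr.
move=> v _; lia.
Qed.

Lemma pr_and n A B : pr n (fun v => nat_of_bool (A v)) ->
  pr n (fun v => nat_of_bool (B v)) -> pr n (fun v => nat_of_bool (A v && B v)).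
Proof. by move=> AP BP; apply: pr_ext (pr_mul AP BP) => v _; rewrite mulnb. Qed.

Lemma pr_neg n A : pr n (fun v => nat_of_bool (A v)) ->
  pr n (fun v => nat_of_bool (~~ A v)).
Proof.
by move=> AP; apply: pr_ext (pr_sub (pr_const n 1) AP) => v _; case: (A v).
Qed.
#[local] Hint Resolve pr_half pr_leq pr_and pr_neg : pr.

Lemma pr_or n A B : pr n (fun v => nat_of_bool (A v)) ->
  pr n (fun v => nat_of_bool (B v)) -> pr n (fun v => nat_of_bool (A v || B v)).
Proof.
move=> AP BP; apply: (@pr_ext _ (fun v => nat_of_bool (~~ (~~ A v && ~~ B v)))).
  by move=> v _; rewrite negb_and !negbK.
auto with pr.
Qed.

Lemma pr_eq n A B :
  pr n A -> pr n B -> pr n (fun v => nat_of_bool (A v == B v)).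
Proof.
move=> AP BP; apply: (@pr_ext _ (fun v => nat_of_bool ((A v <= B v) && (B v <= A v)))).
  by move=> v _; rewrite -eqn_leq.
auto with pr.
Qed.

Lemma pr_if n A B C : pr n (fun v => nat_of_bool (A v)) -> pr n B -> pr n C ->
  pr n (fun v => if A v then B v else C v).
Proof.
move=> AP BP CP.
apply: (@pr_ext _ (fun v => A v * B v + (1 - A v) * C v)); last by auto with pr.
by move=> v _; case: (A v); rewrite ?mul1n ?mul0n ?addn0.
Qed.

Lemma pr_odd n A : pr n A -> pr n (fun v => nat_of_bool (odd (A v))).
Proof.
move=> AP; apply: (@pr_ext _ (fun v => A v - 2 * (A v)./2)); last by auto with pr.
move=> v _; lia.
Qed.
#[local] Hint Resolve pr_or pr_eq pr_if pr_odd : pr.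

(** Bounded search as an iteration: [r] sticks at the first value satisfying [P], and the result [n]
    signals failure. *)
Definition bmin (P : pred nat) (n : nat) : nat :=
  iter n (fun r => if P r then r else r.+1) 0.

Lemma bminP (P : pred nat) n :
  [/\ bmin P n <= n, forall k, k < bmin P n -> ~~ P k &
      bmin P n < n -> P (bmin P n)].
Proof.
elim: n => [|n [le_n minP P_n]] //=; case: ifP => [Pn|/negbT nPn].
  by split=> //; exact: leqW.
have eq_n : bmin P n = n.
  by apply/eqP; rewrite eqn_leq le_n leqNgt; apply: contra nPn; exact: P_n.
split=> [|k|]; rewrite eq_n ?ltnn // ltnS leq_eqVlt => /predU1P[->|].
  by rewrite -eq_n.
by rewrite -[X in _ < X]eq_n; exact: minP.
Qed.

Lemma bminE (P : pred nat) n : reflect (exists2 k, k < n & P k) (bmin P n < n).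
Proof.
have [le_n minP Pmin] := bminP P n.
apply: (iffP idP) => [lt_n|[k lt_kn Pk]];
  first by exists (bmin P n); last exact: Pmin.
rewrite ltnNge; apply/negP => le_bn.
by have := minP k (leq_trans lt_kn le_bn); rewrite Pk.
Qed.

Lemma bmin_eq (P : pred nat) n m : m < n -> P m ->
  (forall k, k < m -> ~~ P k) -> bmin P n = m.
Proof.
move=> lt_mn Pm minm; have [le_n minP P_n] := bminP P n.
case: (ltngtP (bmin P n) m) => // [lt_m|/minP]; last by rewrite Pm.
by have := minm _ lt_m; rewrite P_n // (ltn_trans lt_m).
Qed.

Lemma pr_bmin n B P : pr n B ->
  pr n.+1 (fun w => nat_of_bool (P (nth 0 w 0) (drop 1 w))) ->
  pr n (fun v => bmin (fun x => P x v) (B v)).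
Proof.
move=> BP PP; apply: (@pr_iter n B _ (fun r v => if P r v then r else r.+1));
  auto with pr.
Qed.

(** * Coding pairs and lists *)

(* The pair (a, b) is found back from (a + b)^2 + a, which lies between two   *)
(* consecutive squares.                                                       *)
Definition npair (a b : nat) : nat := (a + b) * (a + b) + a.
Definition nsqrt (z : nat) : nat := bmin (fun r => z < r.+1 * r.+1) z.
Definition nfst (z : nat) : nat := z - nsqrt z * nsqrt z.
Definition nsnd (z : nat) : nat := nsqrt z - nfst z.

Lemma nsqrt_npair a b : nsqrt (npair a b) = a + b.
Proof.
have [z0|z_gt0] := posnP (npair a b).
  by rewrite z0 /nsqrt /bmin /=; move: z0; rewrite /npair; nia.
have [le_z minz P_z] := bminP (fun r => npair a b < r.+1 * r.+1) (npair a b).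
rewrite /nsqrt; move: (bmin _ _) le_z minz P_z => m le_z minz P_z.
have lt_z : npair a b < m.+1 * m.+1.
  (* If the search fails, [m] is the number [npair a b] itself, and the inequality is trivial. *)
  by move: le_z; rewrite leq_eqVlt => /predU1P[->|/P_z //]; nia.
have [lt_m|lt_m|//] := ltngtP m (a + b).
  by move: lt_z; rewrite /npair; nia.
by have := minz _ lt_m; rewrite /npair; nia.
Qed.

Lemma nfstK a b : nfst (npair a b) = a.
Proof. by rewrite /nfst nsqrt_npair /npair addKn. Qed.

Lemma nsndK a b : nsnd (npair a b) = b.
Proof. by rewrite /nsnd nfstK nsqrt_npair addKn. Qed.

Lemma nfst_le z : nfst z <= z.
Proof. exact: leq_subr. Qed.

Lemma pr_npair n A B : pr n A -> pr n B -> pr n (fun v => npair (A v) (B v)).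
Proof. by move=> AP BP; rewrite /npair; auto with pr. Qed.

Lemma pr_nsqrt n A : pr n A -> pr n (fun v => nsqrt (A v)).
Proof.
apply: (@pr_app1 nsqrt).
apply: (@pr_bmin _ _ (fun r v => nth 0 v 0 < r.+1 * r.+1)); auto with pr.
Qed.
#[local] Hint Resolve pr_npair pr_nsqrt : pr.

Lemma pr_nfst n A : pr n A -> pr n (fun v => nfst (A v)).
Proof. by move=> AP; rewrite /nfst; auto with pr. Qed.
#[local] Hint Resolve pr_nfst : pr.

Lemma pr_nsnd n A : pr n A -> pr n (fun v => nsnd (A v)).
Proof. by move=> AP; rewrite /nsnd; auto with pr. Qed.
#[local] Hint Resolve pr_nsnd : pr.

(** The successor reserves 0 for the empty list. *)
Definition lcons (a l : nat) : nat := (npair a l).+1.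
Definition lhead (l : nat) : nat := nfst l.-1.
Definition ltail (l : nat) : nat := nsnd l.-1.

Lemma lheadK a l : lhead (lcons a l) = a.
Proof. exact: nfstK. Qed.

Lemma ltailK a l : ltail (lcons a l) = l.
Proof. exact: nsndK. Qed.

Lemma pr_lcons n A B : pr n A -> pr n B -> pr n (fun v => lcons (A v) (B v)).
Proof. by move=> AP BP; rewrite /lcons; auto with pr. Qed.

Lemma pr_lhead n A : pr n A -> pr n (fun v => lhead (A v)).
Proof. by move=> AP; rewrite /lhead; auto with pr. Qed.

Lemma pr_ltail n A : pr n A -> pr n (fun v => ltail (A v)).
Proof. by move=> AP; rewrite /ltail; auto with pr. Qed.
#[local] Hint Resolve pr_lcons pr_lhead pr_ltail : pr.

Definition lcode : seq nat -> nat := foldr lcons 0.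

Lemma lcode_cons a l : lcode (a :: l) = lcons a (lcode l).
Proof. by []. Qed.

Local Opaque npair nfst nsnd.

(** * A universal machine *)

(* Stack machine: a state is the last returned value and a stack of frames.   *)
(* [Ev p v] runs p on v; [Args f gs v acc] runs the remaining argument        *)
(* programs gs, last argument first, then f on their outputs; [Push], [RecF]  *)
(* and [MuF] wait for the output of the frame above them.                     *)
Inductive frame : Type :=
| Ev of program & seq nat
| Args of program & seq program & seq nat & seq nat
| Push of program & seq program & seq nat & seq nat
| RecF of program & nat & seq nat
| MuF of program & seq nat & nat.

(** An empty stack means that the run has halted. Undefined cases, such as [Succ] without arguments,
    are fixed points with a nonempty stack and so count as divergence. *)
Definition step (s : nat * seq frame) : nat * seq frame :=
  let: (y, K) := s in
  match K with
  | Ev Zero v :: K => (0, K)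
  | Ev Succ (x :: v) :: K => (x.+1, K)
  | Ev (Proj 0) (x :: v) :: K => (x, K)
  | Ev (Proj i.+1) (x :: v) :: K => (y, Ev (Proj i) v :: K)
  | Ev (Comp f gs) v :: K => (y, Args f (rev gs) v [::] :: K)
  | Ev (PrimRec f g) (0 :: v) :: K => (y, Ev f v :: K)
  | Ev (PrimRec f g) (n.+1 :: v) :: K =>
      (y, [:: Ev (PrimRec f g) (n :: v), RecF g n v & K])
  | Ev (Mu f) v :: K => (y, [:: Ev f (0 :: v), MuF f v 0 & K])
  | Args f [::] v acc :: K => (y, Ev f acc :: K)
  | Args f (g :: gs) v acc :: K => (y, [:: Ev g v, Push f gs v acc & K])
  | Push f gs v acc :: K => (y, Args f gs v (y :: acc) :: K)
  | RecF g n v :: K => (y, Ev g [:: n, y & v] :: K)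
  | MuF f v z :: K =>
      if y == 0 then (z, K) else (y, [:: Ev f (z.+1 :: v), MuF f v z.+1 & K])
  | _ => s
  end.

(** Since [gs] is in reverse order, [catrev w acc] lists all outputs in the original order. *)
Definition args_return f gs v acc z := exists w,
  [/\ size w = size gs,
      forall i, i < size gs -> returns (nth Zero gs i) v (nth 0 w i) &
      returns f (catrev w acc) z].

(** Big-step meaning of a frame that receives [y] and passes on [z]. For [MuF], [y] is the value of
    [f] at the candidate [z0]; if it is nonzero the search goes on above [z0]. *)
Definition frame_returns (fr : frame) (y z : nat) : Prop :=
  match fr with
  | Ev p v => returns p v z
  | Args f gs v acc => args_return f gs v acc z
  | Push f gs v acc => args_return f gs v (y :: acc) z
  | RecF g n v => returns g [:: n, y & v] z
  | MuF f v z0 => if y == 0 then z = z0 else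
      exists r : nat -> nat, [/\ z0 < z,
        forall k, z0 < k < z -> returns f (k :: v) (r k).+1 &
        returns f (z :: v) 0]
  end.

Fixpoint stack_returns (K : seq frame) (y : nat) : Prop :=
  if K is fr :: K then exists2 z, frame_returns fr y z & stack_returns K z
  else True.

(** Soundness of the machine: the property is trivial for an empty stack and is pulled back along
    each step, so it holds at the start of every halting run. *)
Lemma stack_returns_step s :
  stack_returns (step s).2 (step s).1 -> stack_returns s.2 s.1.
Proof.
case: s => y [|[p v|f [|g gs] v acc|f gs v acc|g n v|f v z] K] //=.
- case: p => [||i|f gs|f g|f] /=.
  + by move=> H; exists 0 => //; exact: returns_Zero.
  + by case: v => [|x v] //= H; exists x.+1 => //; exact: returns_Succ.
  + case: i v => [|i] [|x v] //=.
      by move=> H; exists x => //; exact: (@returns_Proj 0 (x :: v)).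
    move=> [z Hz HK]; exists z => //.
    inversion Hz; subst; exact: (@returns_Proj i.+1 (x :: v)).
  + move=> [z [w [sw wP fP]] HK]; exists z => //.
    rewrite size_rev in sw wP; rewrite catrevE cats0 in fP.
    apply: returns_Comp fP; first by rewrite size_rev.
    move=> i lti; rewrite nth_rev ?sw //; set k := _ - _.
    have ltk : k < size gs by rewrite /k; lia.
    have := wP k ltk; rewrite nth_rev //.
    by have -> : size gs - k.+1 = i by rewrite /k; lia.
  + case: v => [|[|n] v] //=; first by move=> [z Hz HK]; exists z => //; exact: returns_PrimRec0.
    by move=> [r Hr [z Hz HK]]; exists z => //; exact: returns_PrimRecS Hr Hz.
  + move=> [y0 + [z]]; case: (eqVneq y0 0) => [-> Hy -> HK|y0_neq0 Hy [r [z_gt0 rP fP]] HK].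
      by exists 0 => //; apply: (@returns_Mu f v 0 id).
    exists z => //.
    (* The value at 0 is the nonzero [y0] just received; [r] covers only the later candidates. *)
    apply: (@returns_Mu f v z (fun k => if k == 0 then y0.-1 else r k)) => //.
    move=> [|k] ltk /=; first by rewrite prednK // lt0n.
    exact: rP.
- by move=> [z Hz HK]; exists z => //; exists [::].
- move=> [a Ha [z [w [sw wP fP]] HK]]; exists z => //; exists (a :: w).
  by split=> //=; [rewrite sw|case].
- case: (eqVneq y 0) => //= [_ HK|y_neq0]; first by exists z.
  move=> [y0 + [t]]; case: (eqVneq y0 0) => [-> Hy -> HK|y0_neq0 Hy [r [lt_zt rP fP]] HK].
    exists z.+1 => //; exists id; split=> //.
    by move=> k; rewrite ltnS; case: ltngtP.
  exists t => //; exists (fun k => if k == z.+1 then y0.-1 else r k).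
  split=> //; first exact: ltnW.
  move=> k /andP[lt_zk lt_kt]; case: eqP => [->|/eqP neq_k].
    by rewrite prednK // lt0n.
  by apply: rP; rewrite lt_kt andbT ltn_neqAle eq_sym neq_k.
Qed.

Definition reaches s s' := exists t, iter t step s = s'.

Lemma reaches_refl s : reaches s s.
Proof. by exists 0. Qed.

Lemma reaches_trans s s' s'' : reaches s s' -> reaches s' s'' -> reaches s s''.
Proof. by move=> [t <-] [u <-]; exists (u + t); rewrite iterD. Qed.

Lemma reaches_step s s' : reaches (step s) s' -> reaches s s'.
Proof. by apply: reaches_trans; exists 1. Qed.

Lemma reaches_args f gs v w acc y K : size w = size gs ->
  (forall i, i < size gs -> forall y K,
     reaches (y, Ev (nth Zero gs i) v :: K) (nth 0 w i, K)) ->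
  exists y', reaches (y, Args f gs v acc :: K) (y', Ev f (catrev w acc) :: K).
Proof.
elim: gs w acc y => [|g gs IH] [|a w] acc y //= => [_ _|[sw] wP].
  by exists y; apply: reaches_step; exact: reaches_refl.
have [y' y'P] := IH w (a :: acc) a sw (fun i => wP i.+1).
exists y'; apply: reaches_step; apply: reaches_trans (wP 0 isT _ _) _.
exact: reaches_step.
Qed.

(** Completeness of the machine, by induction on the derivation; quantifying over [y] and [K] lets
    subcomputations run on top of any stack. *)
Lemma reaches_returns p v z : returns p v z ->
  forall y K, reaches (y, Ev p v :: K) (z, K).
Proof.
elim=> {p v z} [v|x v|i v|f gs v w z sw _ wP _ fP|f g v z _ fP|f g n v r z _ rP _ gP
               |f v z r _ rP _ fP] y K.
- by exists 1.
- by exists 1.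
- elim: i v y => [|i IH] [|x v] y //= ltiv; first by exists 1.
  by apply: reaches_step; exact: IH.
- have [||y' y'P] := @reaches_args f (rev gs) v (rev w) [::] y K.
  + by rewrite !size_rev.
  + move=> i; rewrite size_rev => lti; rewrite !nth_rev ?sw //.
    by apply: wP; lia.
  rewrite catrevE revK cats0 in y'P.
  apply: reaches_step; apply: reaches_trans y'P _; exact: fP.
- by apply: reaches_step; exact: fP.
- apply: reaches_step; apply: reaches_trans (rP _ _) _.
  by apply: reaches_step; exact: gP.
- have [y' y'P] : exists y', reaches (y, Ev (Mu f) v :: K)
                                (y', [:: Ev f (z :: v), MuF f v z & K]).
    elim: {fP} z rP => [|z IH] rP; first by exists y; exists 1.
    have [k ltk|y' y'P] := IH; first by apply: rP; exact: leqW.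
    exists (r z).+1; apply: reaches_trans y'P _.
    by apply: reaches_trans (rP z (ltnSn z) _ _) _; exists 1.
  by apply: reaches_trans y'P _; apply: reaches_trans (fP _ _) _; exists 1.
Qed.

(** The argument programs of [Comp] are stored in reverse, as [Args] wants them, which spares
    [nstep] a list reversal. *)
Fixpoint code (p : program) : nat :=
  match p with
  | Zero => npair 0 0
  | Succ => npair 1 0
  | Proj i => npair 2 i
  | Comp f gs => npair 3 (npair (code f) (lcode (rev (map code gs))))
  | PrimRec f g => npair 4 (npair (code f) (code g))
  | Mu f => npair 5 (code f)
  end.

Definition nEv p v := npair 0 (npair p v).
Definition nArgs f gs v acc := npair 1 (npair (npair f gs) (npair v acc)).
Definition nPush f gs v acc := npair 2 (npair (npair f gs) (npair v acc)).
Definition nRecF g n v := npair 3 (npair g (npair n v)).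
Definition nMuF f v z := npair 4 (npair f (npair v z)).

Definition code_frame (fr : frame) : nat :=
  match fr with
  | Ev p v => nEv (code p) (lcode v)
  | Args f gs v acc => nArgs (code f) (lcode (map code gs)) (lcode v) (lcode acc)
  | Push f gs v acc => nPush (code f) (lcode (map code gs)) (lcode v) (lcode acc)
  | RecF g n v => nRecF (code g) n (lcode v)
  | MuF f v z => nMuF (code f) (lcode v) z
  end.

Definition code_state (s : nat * seq frame) : nat :=
  npair s.1 (lcode (map code_frame s.2)).

Definition nstep_Ev (s y p v K : nat) : nat :=
  let q := nsnd p in
  if nfst p == 0 then npair 0 K
  else if nfst p == 3 then
    npair y (lcons (nArgs (nfst q) (nsnd q) v 0) K)
  else if nfst p == 5 then
    npair y (lcons (nEv q (lcons 0 v)) (lcons (nMuF q v 0) K))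
  else if v == 0 then s
  else if nfst p == 1 then npair (lhead v).+1 K
  else if nfst p == 2 then
    if q == 0 then npair (lhead v) K
    else npair y (lcons (nEv (npair 2 q.-1) (ltail v)) K)
  else if lhead v == 0 then npair y (lcons (nEv (nfst q) (ltail v)) K)
  else npair y (lcons (nEv p (lcons (lhead v).-1 (ltail v)))
                 (lcons (nRecF (nsnd q) (lhead v).-1 (ltail v)) K)).

(** The local names fit [Args] and [Push]. In the [RecF] case [v] is the counter and [acc] the
    parameter list; in the [MuF] case [acc] is the candidate. *)
Definition nstep_frame (s y tag b K : nat) : nat :=
  let f := nfst (nfst b) in let gs := nsnd (nfst b) in
  let v := nfst (nsnd b) in let acc := nsnd (nsnd b) in
  if tag == 0 then nstep_Ev s y (nfst b) (nsnd b) K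
  else if tag == 1 then
    if gs == 0 then npair y (lcons (nEv f acc) K)
    else npair y (lcons (nEv (lhead gs) v) (lcons (nPush f (ltail gs) v acc) K))
  else if tag == 2 then npair y (lcons (nArgs f gs v (lcons y acc)) K)
  else if tag == 3 then
    npair y (lcons (nEv (nfst b) (lcons v (lcons y acc))) K)
  else if y == 0 then npair acc K
  else npair y (lcons (nEv (nfst b) (lcons acc.+1 v))
                 (lcons (nMuF (nfst b) v acc.+1) K)).

Definition nstep (s : nat) : nat :=
  if nsnd s == 0 then s else
  nstep_frame s (nfst s) (nfst (lhead (nsnd s))) (nsnd (lhead (nsnd s)))
              (ltail (nsnd s)).

Lemma nstep_code s : nstep (code_state s) = code_state (step s).
Proof.
have fstE y K : nfst (code_state (y, K)) = y by exact: nfstK.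
have sndE y K : nsnd (code_state (y, K)) = lcode (map code_frame K).
  exact: nsndK.
have E := (fstE, sndE, nfstK, nsndK, lheadK, ltailK).
case: s => y [|fr K]; first by rewrite /nstep !E.
rewrite /nstep sndE map_cons lcode_cons !E /=; set s := code_state _.
rewrite /nstep_frame.
case: fr @s => [p v|f [|g gs] v acc|f gs v acc|g n v|f v z] s.
all: rewrite /code_frame -/code_frame /step.
all: rewrite ?/nEv ?/nArgs ?/nPush ?/nRecF ?/nMuF ?map_cons ?lcode_cons !E /=.
all: rewrite ?/code_state //=.
  2: by case: ifP.
rewrite /nstep_Ev.
case: p @s => [||i|f gs|f g|f] s /=; rewrite !E //=.
- by case: v @s => [|x v] s; rewrite ?lcode_cons ?E.
- by case: v i @s => [|x v] [|i] s; rewrite ?lcode_cons ?E.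
- by rewrite /code_state /= map_rev.
- by case: v @s => [|[|n] v] s; rewrite ?lcode_cons ?E.
Qed.

Definition halts_at (e x t : nat) : bool :=
  nsnd (iter t nstep (npair 0 (lcons (nEv e (lcons x 0)) 0))) == 0.

(** By [nstep_code] the numerical run mirrors the machine; [stack_returns_step] gives one direction
    and [reaches_returns] the other. *)
Lemma halts_atP p x :
  (exists t, halts_at (code p) x t) <-> exists y, returns p [:: x] y.
Proof.
pose s := (0, [:: Ev p [:: x]]).
have haltE t : halts_at (code p) x t = nilp (iter t step s).2.
  have -> : halts_at (code p) x t = (nsnd (code_state (iter t step s)) == 0).
    congr (nsnd _ == 0); elim: t => //= t ->; exact: nstep_code.
  by rewrite /code_state nsndK; case: (_.2).
split=> [[t]|[y /reaches_returns/(_ 0 [::])[t tP]]]; last first.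
  by exists t; rewrite haltE tP.
rewrite haltE => halt_t.
suff [z Hz _] : stack_returns s.2 s.1 by exists z.
elim: t s {haltE} halt_t => [|t IH] s; first by case: s.2.
by rewrite iterSr => /IH /stack_returns_step.
Qed.

Lemma pr_nEv n A B : pr n A -> pr n B -> pr n (fun v => nEv (A v) (B v)).
Proof. by move=> AP BP; rewrite /nEv; auto with pr. Qed.

Lemma pr_nArgs n A B C D : pr n A -> pr n B -> pr n C -> pr n D ->
  pr n (fun v => nArgs (A v) (B v) (C v) (D v)).
Proof. by move=> AP BP CP DP; rewrite /nArgs; auto 6 with pr. Qed.

Lemma pr_nPush n A B C D : pr n A -> pr n B -> pr n C -> pr n D ->
  pr n (fun v => nPush (A v) (B v) (C v) (D v)).
Proof. by move=> AP BP CP DP; rewrite /nPush; auto 6 with pr. Qed.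

Lemma pr_nRecF n A B C : pr n A -> pr n B -> pr n C ->
  pr n (fun v => nRecF (A v) (B v) (C v)).
Proof. by move=> AP BP CP; rewrite /nRecF; auto with pr. Qed.

Lemma pr_nMuF n A B C : pr n A -> pr n B -> pr n C ->
  pr n (fun v => nMuF (A v) (B v) (C v)).
Proof. by move=> AP BP CP; rewrite /nMuF; auto with pr. Qed.
#[local] Hint Resolve pr_nEv pr_nArgs pr_nPush pr_nRecF pr_nMuF : pr.

Lemma pr_nstep_Ev n S Y P V K : pr n S -> pr n Y -> pr n P -> pr n V -> pr n K ->
  pr n (fun v => nstep_Ev (S v) (Y v) (P v) (V v) (K v)).
Proof. by move=> *; rewrite /nstep_Ev; auto 20 with pr. Qed.
#[local] Hint Resolve pr_nstep_Ev : pr.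

Lemma pr_nstep_frame n S Y T B K :
  pr n S -> pr n Y -> pr n T -> pr n B -> pr n K ->
  pr n (fun v => nstep_frame (S v) (Y v) (T v) (B v) (K v)).
Proof. by move=> *; rewrite /nstep_frame; auto 20 with pr. Qed.
#[local] Hint Resolve pr_nstep_frame : pr.

Lemma pr_nstep n S : pr n S -> pr n (fun v => nstep (S v)).
Proof. by move=> SP; rewrite /nstep; auto 20 with pr. Qed.
#[local] Hint Resolve pr_nstep : pr.

Lemma pr_halts_at n E X T : pr n E -> pr n X -> pr n T ->
  pr n (fun v => nat_of_bool (halts_at (E v) (X v) (T v))).
Proof.
move=> EP XP TP; rewrite /halts_at; apply: pr_eq; last exact: pr_const.
apply: pr_nsnd; apply: (@pr_iter _ T _ (fun s _ => nstep s)); auto 10 with pr.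
Qed.
#[local] Hint Resolve pr_halts_at : pr.

(** * Positions in the binary tree *)

(* Positions in the full binary tree, numbered as in a heap: the root is 0    *)
(* and the children of n are 2n+1 and 2n+2 (so [par 0 = 0]).                  *)
Definition par (n : nat) : nat := n.-1./2.

(** The ancestor relation. The search is bounded to keep it computable; [b] steps up from [b]
    already lead to the root. *)
Definition pre (a b : nat) : bool :=
  bmin (fun k => iter k par b == a) b.+1 < b.+1.

Lemma iter_par_le k b : iter k par b <= b - k.
Proof. elim: k => [|k IH] /=; rewrite ?subn0 //.
by move: (iter k par b) IH => m; rewrite /par; lia.
Qed.

Lemma preP a b : reflect (exists k, iter k par b = a) (pre a b).
Proof.
apply: (iffP (bminE _ _)) => [[k _ /eqP <-]|[k <-]]; first by exists k.
case: (leqP k b) => [le_kb|lt_bk]; first by exists k.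
exists b => //; have := iter_par_le k b; have := iter_par_le b b.
by rewrite subnn (eqnP (ltnW lt_bk)) !leqn0 => /eqP-> /eqP->.
Qed.

Lemma pre_refl a : pre a a.
Proof. by apply/preP; exists 0. Qed.

Lemma pre_trans a b c : pre a b -> pre b c -> pre a c.
Proof. by move=> /preP[k <-] /preP[l <-]; apply/preP; exists (k + l); rewrite iterD. Qed.

Lemma pre_le a b : pre a b -> a <= b.
Proof. by move=> /preP[k <-]; apply: leq_trans (iter_par_le _ _) (leq_subr _ _). Qed.

Lemma pre_anti a b : pre a b -> pre b a -> a = b.
Proof. by move=> /pre_le ? /pre_le ?; apply/eqP; rewrite eqn_leq; apply/andP. Qed.

Lemma pre_linear a b c : pre a c -> pre b c -> pre a b || pre b a.
Proof.
move=> /preP[k <-] /preP[l <-]; case/orP: (leq_total k l) => [le_kl|le_lk].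
  by apply/orP; right; apply/preP; exists (l - k); rewrite -iterD subnK.
by apply/orP; left; apply/preP; exists (k - l); rewrite -iterD subnK.
Qed.

Lemma pre_par n : pre (par n) n.
Proof. by apply/preP; exists 1. Qed.

Lemma pre_parr a b : pre a b -> a != b -> pre a (par b).
Proof.
move=> /preP[[|k]]; first by move=> /= ->; rewrite eqxx.
by rewrite iterSr => <- _; apply/preP; exists k.
Qed.

Lemma pre0 b : pre 0 b.
Proof.
apply/preP; exists b; have := iter_par_le b b.
by rewrite subnn leqn0 => /eqP.
Qed.

(** Climb from [z] through its parents until the parent is [a]. *)
Lemma pre_child a z : pre a z -> z != a -> pre (2 * a).+1 z || pre (2 * a).+2 z.
Proof.
elim/ltn_ind: z => z IH az neq_za.
have [par_z|neq_pa] := eqVneq (par z) a.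
  have [->|->] : z = (2 * a).+1 \/ z = (2 * a).+2.
    by move: neq_za => /eqP; rewrite -par_z /par; lia.
    by rewrite pre_refl.
  by rewrite pre_refl orbT.
have apz : pre a (par z) by apply: pre_parr; rewrite // eq_sym.
have z_gt0 : par z < z by move: (pre_le apz) neq_pa neq_za ; rewrite /par; lia.
by have /orP[] := IH _ z_gt0 apz neq_pa => /pre_trans/(_ (pre_par z)) ->; rewrite ?orbT.
Qed.

Lemma children_disjoint a z : pre (2 * a).+1 z -> ~~ pre (2 * a).+2 z.
Proof.
move=> az; apply/negP => /(pre_linear az) /orP[] H; last by have := pre_le H; lia.
have /pre_parr/(_ _)/pre_le := H; rewrite /par /=; lia.
Qed.

(** For [z] strictly above [a], the child of [a] on the side away from [z]. *)
Definition flip (a z : nat) : nat :=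
  if pre (2 * a).+1 z then (2 * a).+2 else (2 * a).+1.

Lemma flip_incomparable a z y : pre a z -> z != a -> pre (flip a z) y ->
  ~~ pre z y /\ ~~ pre y z.
Proof.
move=> az neq_za fy.
have flip_above u : pre z u -> ~~ pre (flip a z) u.
  move=> zu; rewrite /flip; case: ifP => [cz|/negbT ncz].
    exact: children_disjoint (pre_trans cz zu).
  have /orP[cz|cz] := pre_child az neq_za; first by rewrite cz in ncz.
  by apply/negP => /children_disjoint/negP; apply; exact: pre_trans cz zu.
split; first by apply/negP => /flip_above; rewrite fy.
by apply: contra (flip_above z (pre_refl z)); exact: pre_trans.
Qed.

Lemma pre_flip a z : pre a (flip a z).
Proof.
suff {1}<- : par (flip a z) = a by exact: pre_par.
by rewrite /flip /par; case: ifP => _ /=; lia.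
Qed.

(** * The construction *)

(* In the following, h codes the list of the first s nodes, last one first.   *)
Definition entry (h s x : nat) : nat := lhead (iter (s - x.+1) ltail h).

(** Here [w] codes a pair of an element and a time by which it has been enumerated. As
    [nfst w <= w], a witness [w < s] concerns a node already placed. *)
Definition is_witness (h s j a w : nat) : bool :=
  [&& halts_at j./2 (nfst w) (nsnd w), pre a (entry h s (nfst w)) &
      entry h s (nfst w) != a].

Definition lock (h s j a : nat) : nat :=
  let w := bmin (is_witness h s j a) s in
  if w < s then
    if odd j then entry h s (nfst w) else flip a (entry h s (nfst w))
  else a.

Definition locks (h s j : nat) : nat :=
  nat_rec (fun=> nat) 0 (fun i a => lock h s i a) j.

(** The search bound is the position [s] steps above the lock on the leftmost branch; of the [s.+1]
    positions up to there, at most [s] are occupied. *)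
Definition next_node (h s : nat) : nat :=
  bmin (fun n => (pre n (locks h s s) || pre (locks h s s) n) &&
                 ~~ (bmin (fun x => entry h s x == n) s < s))
       (iter s (fun r => (2 * r).+1) (locks h s s)).+1.

Definition history (s : nat) : nat :=
  nat_rec (fun=> nat) 0 (fun k h => lcons (next_node h k) h) s.

Definition node (s : nat) : nat := next_node (history s) s.

(** * Computability of the construction *)

Lemma pr_par n A : pr n A -> pr n (fun v => par (A v)).
Proof. by move=> AP; rewrite /par; auto with pr. Qed.
#[local] Hint Resolve pr_par : pr.

Lemma pr_pre n A B : pr n A -> pr n B -> pr n (fun v => nat_of_bool (pre (A v) (B v))).
Proof.
apply: (@pr_app2 (fun a b => nat_of_bool (pre a b))); apply: pr_leq; last by auto with pr.
apply: pr_succ; apply: (@pr_bmin _ _ (fun k v => iter k par (nth 0 v 1) == nth 0 v 0)).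
  by auto with pr.
apply: pr_eq; last by auto with pr.
by apply: (@pr_iter _ _ _ (fun r _ => par r)); auto with pr.
Qed.
#[local] Hint Resolve pr_pre : pr.

Lemma pr_flip n A B : pr n A -> pr n B -> pr n (fun v => flip (A v) (B v)).
Proof. by move=> *; rewrite /flip; auto 10 with pr. Qed.

Lemma pr_entry n H S X : pr n H -> pr n S -> pr n X ->
  pr n (fun v => entry (H v) (S v) (X v)).
Proof.
move=> HP SP XP; rewrite /entry; apply: pr_lhead.
by apply: (@pr_iter _ _ _ (fun r _ => ltail r)); auto with pr.
Qed.
#[local] Hint Resolve pr_flip pr_entry : pr.

Lemma pr_is_witness n H S J A W : pr n H -> pr n S -> pr n J -> pr n A -> pr n W ->
  pr n (fun v => nat_of_bool (is_witness (H v) (S v) (J v) (A v) (W v))).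
Proof. by move=> *; rewrite /is_witness; auto 10 with pr. Qed.
#[local] Hint Resolve pr_is_witness : pr.

Lemma pr_lock n H S J A : pr n H -> pr n S -> pr n J -> pr n A ->
  pr n (fun v => lock (H v) (S v) (J v) (A v)).
Proof.
apply: (@pr_app4 lock).
have wP : pr 4 (fun v => bmin (is_witness (nth 0 v 0) (nth 0 v 1) (nth 0 v 2) (nth 0 v 3))
                              (nth 0 v 1)).
  apply: (@pr_bmin _ _ (fun w v =>
    is_witness (nth 0 v 0) (nth 0 v 1) (nth 0 v 2) (nth 0 v 3) w)); auto with pr.
by rewrite /lock; auto 10 with pr.
Qed.
#[local] Hint Resolve pr_lock : pr.

Lemma pr_locks n H S J : pr n H -> pr n S -> pr n J ->
  pr n (fun v => locks (H v) (S v) (J v)).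
Proof.
apply: (@pr_app3 locks).
by apply: (@pr_rec _ _ _ (fun i a v => lock (nth 0 v 0) (nth 0 v 1) i a)); auto with pr.
Qed.
#[local] Hint Resolve pr_locks : pr.

Lemma pr_used n H S X : pr n H -> pr n S -> pr n X ->
  pr n (fun v => nat_of_bool (bmin (fun x => entry (H v) (S v) x == X v) (S v) < S v)).
Proof.
apply: (@pr_app3 (fun h s n => nat_of_bool (bmin (fun x => entry h s x == n) s < s))).
apply: pr_leq; last by auto with pr.
apply: pr_succ.
by apply: (@pr_bmin _ _ (fun x v => entry (nth 0 v 0) (nth 0 v 1) x == nth 0 v 2));
  auto with pr.
Qed.
#[local] Hint Resolve pr_used : pr.

Lemma pr_next_node n H S : pr n H -> pr n S -> pr n (fun v => next_node (H v) (S v)).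
Proof.
apply: (@pr_app2 next_node).
apply: (@pr_bmin _ _ (fun n v =>
  (pre n (locks (nth 0 v 0) (nth 0 v 1) (nth 0 v 1)) ||
   pre (locks (nth 0 v 0) (nth 0 v 1) (nth 0 v 1)) n) &&
  ~~ (bmin (fun x => entry (nth 0 v 0) (nth 0 v 1) x == n) (nth 0 v 1) < nth 0 v 1))).
  by apply: pr_succ; apply: (@pr_iter _ _ _ (fun r _ => (2 * r).+1)); auto with pr.
by auto 10 with pr.
Qed.
#[local] Hint Resolve pr_next_node : pr.

Lemma pr_history n S : pr n S -> pr n (fun v => history (S v)).
Proof.
move=> SP.
by apply: (@pr_rec _ _ _ (fun k h _ => lcons (next_node h k) h)); auto with pr.
Qed.
#[local] Hint Resolve pr_history : pr.

Lemma pr_node n S : pr n S -> pr n (fun v => node (S v)).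
Proof. by move=> SP; rewrite /node; auto with pr. Qed.
#[local] Hint Resolve pr_node : pr.

(** * Placement of the nodes *)

Lemma entry_history s x : x < s -> entry (history s) s x = node x.
Proof.
move=> lt_xs; rewrite /entry.
have -> : iter (s - x.+1) ltail (history s) = history x.+1.
  rewrite -{2}(subnK lt_xs); elim: (s - x.+1) => //= k IH.
  by rewrite -iterS iterSr /= ltailK.
exact: lheadK.
Qed.

Definition stage_lock (s j : nat) : nat := locks (history s) s j.

Lemma stage_lock_mono s i j : i <= j -> pre (stage_lock s i) (stage_lock s j).
Proof.
move=> /subnK <-; elim: (j - i) => [|k IH]; first exact: pre_refl.
apply: pre_trans IH _; rewrite addSn /stage_lock /=.
set a := locks _ _ _; rewrite /lock; case: ifP => [lt_ws|_]; last exact: pre_refl.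
have [_ _ /(_ lt_ws) /and3P[_ aP _]] := bminP (is_witness (history s) s (k + i) a) s.
by case: ifP => _ //; exact: pre_flip.
Qed.

(** The bounded search in [next_node] succeeds, by the pigeonhole principle on the leftmost branch
    [c] above the lock. *)
Lemma nodeP s : let a := stage_lock s s in
  let P n := (pre n a || pre a n) && (n \notin [seq node x | x <- iota 0 s]) in
  P (node s) /\ forall n, P n -> node s <= n.
Proof.
move=> a P.
pose Q n := (pre n a || pre a n) && ~~ (bmin (fun x => entry (history s) s x == n) s < s).
have QP : Q =1 P.
  move=> n; rewrite /Q /P; congr (_ && ~~ _); apply/bminE/mapP => [[x lt_xs /eqP <-]|[x]].
    by exists x; rewrite ?mem_iota // entry_history.
  by rewrite mem_iota => lt_xs ->; exists x; rewrite // entry_history.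
pose c k := iter k (fun r => (2 * r).+1) a.
have c_lt i j : i < j -> c i < c j.
  move=> /subnK <-; elim: (j - i.+1) => [|k IH]; first by rewrite /c /=; lia.
  by apply: leq_trans IH _; rewrite addSn /c /=; lia.
have c_pre k : pre a (c k).
  elim: k => [|k IH]; first exact: pre_refl.
  apply: pre_trans IH _; have {1}-> : c k = par (c k.+1) by rewrite /c /par /=; lia.
  exact: pre_par.
have [k le_ks Pk] : exists2 k, k <= s & P (c k).
  apply: contrapT => nP.
  have : size (mkseq c s.+1) <= size [seq node x | x <- iota 0 s].
    apply: uniq_leq_size.
      rewrite map_inj_uniq ?iota_uniq // => i j cij.
      by case: (ltngtP i j) => // /c_lt; rewrite cij ltnn.
    move=> n /mapP[k]; rewrite mem_iota add0n ltnS => /andP[_ le_ks] ->.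
    apply: contrapT => /negP nk; apply: nP; exists k => //.
    by rewrite /P c_pre orbT.
  by rewrite size_mkseq size_map size_iota ltnn.
have [le_n minQ Qmin] := bminP Q (c s).+1.
have node_lt : node s < (c s).+1.
  apply/bminE; exists (c k); last by rewrite -[is_true _]/(is_true (Q (c k))) QP.
  rewrite ltnS; move: le_ks; rewrite leq_eqVlt => /predU1P[->//|/c_lt]; exact: ltnW.
split; first by rewrite -QP; exact: Qmin.
move=> n; rewrite -QP leqNgt => Qn; apply/negP => /minQ; by rewrite Qn.
Qed.

Lemma node_neq x s : x < s -> node x != node s.
Proof.
move=> lt_xs; have [/andP[_ /mapP ns] _] := nodeP s.
by apply/eqP => eq_n; apply: ns; exists x; rewrite ?mem_iota.
Qed.

Lemma node_inj : injective node.
Proof.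
move=> x y eq_n; case: (ltngtP x y) => // /node_neq; by rewrite eq_n eqxx.
Qed.

(** The parent of a position comparable with the lock is again comparable with it. A free parent
    would therefore be a smaller candidate than [node s]. *)
Lemma node_par s : exists k, node k = par (node s).
Proof.
have [n0|n_neq0] := eqVneq (node s) 0; first by exists s; rewrite n0.
have [/andP[cmp _] mins] := nodeP s.
suff : par (node s) \in [seq node x | x <- iota 0 s] by case/mapP => x _ ->; exists x.
apply: contrapT => /negP nin.
have := mins (par (node s)); rewrite nin andbT => H.
suff /H : pre (par (node s)) (stage_lock s s) || pre (stage_lock s s) (par (node s)).
  by move: n_neq0; rewrite /par; lia.
have [ns|/(pre_trans (pre_par _)) -> //] : pre (stage_lock s s) (node s) \/
   pre (node s) (stage_lock s s) by case/orP: cmp; auto.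
have [<-|neq] := eqVneq (stage_lock s s) (node s); first by rewrite pre_par.
by rewrite (pre_parr ns neq) orbT.
Qed.

Lemma node0 : node 0 = 0.
Proof.
have [_ /(_ 0)] := nodeP 0; rewrite pre0 /= leqn0 => /(_ isT) /eqP //.
Qed.

Lemma infinite_node_gt (A : set nat) N M :
  infinite_set A -> exists x, [/\ A x, N <= x & M < node x].
Proof.
move=> infA; apply: contrapT => nA; apply: infA.
apply: (@sub_finite_set _ _ (`I_N `|` node @^-1` `I_M.+1)).
  move=> x Ax; case: (ltnP x N) => [|le_Nx]; [by left|right] => /=.
  by rewrite ltnS leqNgt; apply/negP => lt_M; apply: nA; exists x.
rewrite finite_setU; split; first exact: finite_II.
apply: finite_preimage; last exact: finite_II.
by move=> x y _ _; exact: node_inj.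
Qed.

(** * Convergence of the locks and satisfaction of the requirements *)

Definition lock_limit (j a : nat) : Prop :=
  exists s0, forall s, s0 <= s -> stage_lock s j = a.

Lemma is_witness_history s j a w : w < s ->
  is_witness (history s) s j a w =
  [&& halts_at j./2 (nfst w) (nsnd w), pre a (node (nfst w)) & node (nfst w) != a].
Proof.
by move=> lt_ws; rewrite /is_witness entry_history //; apply: leq_ltn_trans lt_ws; exact: nfst_le.
Qed.

(** Positions never change once assigned, so after lock [j] has settled the witness condition no
    longer depends on the stage. From then on, every stage beyond the least witness [w0] selects
    [w0]. *)
Lemma lock_limit_witness j a w : lock_limit j a ->
  [&& halts_at j./2 (nfst w) (nsnd w), pre a (node (nfst w)) & node (nfst w) != a] ->
  exists x t, [/\ halts_at j./2 x t, pre a (node x), node x != a &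
    lock_limit j.+1 (if odd j then node x else flip a (node x))].
Proof.
move=> [s0 s0P] wP.
have [w0 w0P minw0] := ex_minnP (ex_intro (fun w => [&& halts_at j./2 (nfst w) (nsnd w),
  pre a (node (nfst w)) & node (nfst w) != a]) w wP).
exists (nfst w0), (nsnd w0); case/and3P: (w0P) => H1 H2 H3; split=> //.
exists (maxn s0 w0.+1) => s; rewrite geq_max => /andP[le_s lt_w].
rewrite /stage_lock /= -[locks _ _ _]/(stage_lock s j) s0P // /lock.
have -> : bmin (is_witness (history s) s j a) s = w0.
  apply: bmin_eq => // [|k lt_k]; first by rewrite is_witness_history.
  rewrite is_witness_history ?(ltn_trans lt_k) //.
  by apply/negP => /minw0; rewrite leqNgt lt_k.
by rewrite lt_w entry_history //; apply: leq_ltn_trans lt_w; exact: nfst_le.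
Qed.

Lemma lock_limit_exists j : exists a, lock_limit j a.
Proof.
elim: j => [|j [a aP]]; first by exists 0, 0.
have [[w wP]|nw] := pselect (exists w, [&& halts_at j./2 (nfst w) (nsnd w),
    pre a (node (nfst w)) & node (nfst w) != a]).
  by have [x [t [_ _ _ H]]] := lock_limit_witness aP wP; eexists; exact: H.
exists a; have [s0 s0P] := aP; exists s0 => s le_s.
rewrite /stage_lock /= -[locks _ _ _]/(stage_lock s j) s0P // /lock.
case: bminE => // -[w lt_ws]; rewrite is_witness_history // => wP.
by case: nw; exists w.
Qed.

(** A late node [x >= j] is placed comparably with a lock above [a], hence comparably with [a]; a
    position numerically larger than [a] cannot lie below [a]. *)
Lemma infinite_above j a (A : set nat) M : lock_limit j a -> infinite_set A ->
  exists x, [/\ A x, pre a (node x) & M < node x].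
Proof.
move=> [s0 s0P] infA.
have [x [Ax]] := infinite_node_gt (maxn s0 j) (maxn a M) infA.
rewrite geq_max gtn_max => /andP[le_s0 le_j] /andP[lt_a lt_M].
exists x; split=> //.
have [/andP[+ _] _] := nodeP x.
have := stage_lock_mono x le_j; rewrite s0P // => ale.
case/orP => [|/(pre_trans ale) //] nx.
by case/orP: (pre_linear ale nx) => // /pre_le; rewrite leqNgt lt_a.
Qed.

(** An infinite set has an element above the limit of lock [j], so some witness exists. The [x]
    obtained belongs to the least witness and may be a different element. *)
Lemma requirement j (A : set nat) :
  (forall x, A x <-> exists t, halts_at j./2 x t) -> infinite_set A ->
  exists a x, [/\ A x, pre a (node x), node x != a &
    lock_limit j.+1 (if odd j then node x else flip a (node x))].
Proof.
move=> AP infA; have [a aP] := lock_limit_exists j.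
have [x [Ax ax lt_a]] := infinite_above a aP infA.
have [t xt] := (AP x).1 Ax.
have [|y [u [yu ay neq_y yP]]] := @lock_limit_witness j a (npair x t) aP.
  by rewrite nfstK nsndK xt ax /= gtn_eqF.
by exists a, y; split=> //; apply/AP; exists u.
Qed.

Lemma ce_halts A : ce_set A -> exists e, forall x, A x <-> exists t, halts_at e x t.
Proof. by move=> [p ->]; exists (code p) => x; rewrite halts_atP. Qed.

Theorem theorem6p3 :
  exists (T : set nat) (le : nat -> nat -> Prop),
    [/\ computable_tree T le,
        infinite_set T,
        binary_branching T le,
        ~ (exists C : set nat, [/\ is_chain T le C, ce_set C & infinite_set C]) &
        ~ (exists A : set nat, [/\ is_antichain T le A, ce_set A & infinite_set A])].
Proof.
exists setT, (fun x y => pre (node x) (node y)); split.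
- split.
  + split=> //.
    * by move=> n _; exact: pre_refl.
    * by move=> m n mn nm; apply: node_inj; exact: pre_anti.
    * by move=> l m n; exact: pre_trans.
    * by exists 0 => // n _; rewrite node0 pre0.
    * move=> n _; apply: (@sub_finite_set _ _ (node @^-1` `I_(node n).+1)).
        by move=> m /pre_le; rewrite /= ltnS.
      apply: finite_preimage; last exact: finite_II.
      by move=> x y _ _; exact: node_inj.
    * by move=> n _; split=> // x y xn yn; apply/orP; exact: pre_linear xn yn.
  + have [p pP] := pr_const 1 1; exists p => x.
    by rewrite asboolT //; exact: pP.
  + have [p pP] : pr 2 (fun v => nat_of_bool (pre (node (nth 0 v 0)) (node (nth 0 v 1)))).
      by auto with pr.
    by exists p => x y; rewrite asboolb; exact: pP.
- exact: infinite_nat.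
- move=> m _.
  have succ_m n : immediate_succ (fun x y => pre (node x) (node y)) m n ->
      node n = (2 * node m).+1 \/ node n = (2 * node m).+2.
    move=> [[mn neq_mn] nk]; have neq : node m != node n.
      by apply/eqP => /node_inj.
    have n_neq0 : node n != 0 by move: (pre_le mn) neq; lia.
    (* The node [k] at the parent position would lie strictly between [m] and [n] unless it is
       [m]. *)
    have [k kP] := node_par n.
    suff <- : node k = node m by rewrite kP /par; lia.
    apply: contrapT => neq_k; apply: nk; exists k; split.
      by split; [rewrite kP; exact: pre_parr | move=> mk; apply: neq_k; rewrite mk].
    split; first by rewrite kP pre_par.
    by move=> kn; move: kP; rewrite kn /par; lia.
  (* Successors are counted by their positions, which are among the two children of [node m]. *)
  set S := [set n | _]; have cardS : node @` S #= S.
    by apply: inj_card_eq => x y _ _; exact: node_inj.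
  rewrite -(card_le_eql cardS).
  apply: card_le_trans (card_image_le (fun i => (2 * node m).+1 + i) `I_2).
  apply: subset_card_le => _ [n /succ_m[]-> <-].
    by exists 0 => //; rewrite addn0.
  by exists 1 => //; rewrite addn1.
- move=> [C [[_ chC] /ce_halts[e eP] infC]].
  (* The even requirement for [e]: later elements of [C] go to the cone away from [x]. *)
  have [|a [x [Cx ax neq_x lim]]] := @requirement e.*2 C _ infC; first by rewrite doubleK.
  rewrite odd_double in lim.
  have [y [Cy fy _]] := infinite_above 0 lim infC.
  have [/negP nxy /negP nyx] := flip_incomparable ax neq_x fy.
  by case: (chC x y Cx Cy).
- move=> [A [[_ acA] /ce_halts[e eP] infA]].
  have [|a [x [Ax ax neq_x lim]]] := @requirement e.*2.+1 A _ infA.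
    by rewrite /= uphalf_double.
  rewrite /= odd_double in lim.
  (* The bound [node x] makes [y] different from [x]. *)
  have [y [Ay xy lt_xy]] := infinite_above (node x) lim infA.
  have neq_xy : x <> y by move=> eq_xy; rewrite eq_xy ltnn in lt_xy.
  by case: (acA x y Ax Ay neq_xy).
Qed.
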